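(* Let $n\ge 4$ be an integer and let $M_1,\dots,M_{n-1}\in\mathbb{R}^n$. If all of the vectors $M_1,\dots,M_{n-1}$ are palindromic, then $$\times(M_1,M_2,\dots,M_{n-1})=\mathbf{0}\in\mathbb{R}^n.$$ The same conclusion holds if all of the vectors $M_1,\dots,M_{n-1}$ are antipalindromic.
   Context: The reversing of a vector $v=(v_1,\dots,v_n)\in\mathbb{R}^n$ is $\overleftarrow{v}=(v_n,v_{n-1},\dots,v_1)$. The vector $v$ is called palindromic if $\overleftarrow{v}=v$ and antipalindromic if $\overleftarrow{v}=-v$. The generalized vector product $\times:(\mathbb{R}^n)^{n-1}\to\mathbb{R}^n$ is $$\times(M_1,\dots,M_{n-1})=\sum_{k=1}^n(-1)^{1+k}\det\left(M^{(k)}\right)e_k,$$ where $e_k$ is the $k$-th standard basis vector of $\mathbb{R}^n$ and $M^{(k)}$ is the $(n-1)\times(n-1)$ matrix obtained by deleting the $k$-th column of the $(n-1)\times n$ matrix $M$ with rows $M_1,\dots,M_{n-1}$. *)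

(* Defs.v *)
From HB Require Import structures.
From mathcomp Require Import all_boot all_order all_algebra.
From mathcomp Require Import reals.

Set Implicit Arguments.
Unset Strict Implicit.
Unset Printing Implicit Defensive.

Import GRing.Theory.
Local Open Scope ring_scope.

Definition reversing (R : Type) (n : nat) (v : 'rV[R]_n) : 'rV[R]_n :=
  \row_(j < n) v ord0 (rev_ord j).

Definition palindromic (R : Type) (n : nat) (v : 'rV[R]_n) : Prop :=
  reversing v = v.

Definition antipalindromic (R : zmodType) (n : nat) (v : 'rV[R]_n) : Prop :=
  reversing v = - v.

(* Indices in 'I_n start at 0, so k.+1 is the usual 1-based column index and
   the sign is (-1)^(1 + k.+1); [delta_mx ord0 k] is the standard basis
   (row) vector. *)
Definition gen_vprod (R : comNzRingType) (n : nat) (M : 'I_n.-1 -> 'rV[R]_n) :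
    'rV[R]_n :=
  \sum_(k < n) ((-1) ^+ (1 + k.+1) * \det (col' k (\matrix_(i < n.-1) M i)))
    *: delta_mx ord0 k.

(* Main.v *)
Require Import Defs.
From mathcomp Require Import all_boot all_order all_algebra.
From mathcomp Require Import reals.
Local Open Scope ring_scope.

(** In both cases the reversing multiplies every row by one common scalar [c]
    ([1] or [-1]), so in the matrix [M] each column is [c] times its mirror
    image.  The mirror pairs [{0, n-1}] and [{1, n-2}] are disjoint and consist
    of two distinct columns each because [4 <= n]; deleting column [k] therefore
    leaves one of them intact ([mirror_pair_avoiding]).  The remaining square
    matrix has two proportional columns, so its determinant vanishes
    ([det_proportional_cols]), and with it every coordinate of the product. *)

Import GRing.Theory.

(** By linearity in column [a] the determinant is [c] times that of the matrix
    with column [a] replaced by column [b], which has a repeated column. *)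
Lemma det_proportional_cols (R : comNzRingType) (m : nat) (A : 'M[R]_m)
    (a b : 'I_m) (c : R) :
  a != b -> (forall i, A i a = c * A i b) -> \det A = 0.
Proof.
move=> neq_ab eqA; rewrite -det_tr.
pose B : 'M[R]_m := \matrix_(i, j) A j (if i == a then b else i).
have BA : row' a B = row' a A^T.
  by apply/matrixP => i j; rewrite !mxE eq_sym (negPf (neq_lift a i)).
rewrite (@determinant_multilinear _ _ _ B B a c 0) //.
  rewrite mul0r addr0 (determinant_alternate neq_ab) ?mulr0 // => j.
  by rewrite !mxE eqxx eq_sym (negPf neq_ab).
by apply/rowP => j; rewrite !mxE eqxx mul0r addr0 eqA.
Qed.

(** The pair of [0] works unless [k] is an extremal index, and then the pair
    of [1] does. *)
Lemma mirror_pair_avoiding (n : nat) (k : 'I_n) :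
  (4 <= n)%N -> exists j : 'I_n, [&& k != j, k != rev_ord j & rev_ord j != j].
Proof.
case: n k => [|[|[|[|n]]]] // k _.
case: (boolP ((k == ord0) || (k == rev_ord ord0))) => [kend|/norP[k0 kmax]].
  exists (Ordinal (isT : (1 < n.+4)%N)).
  by case/orP: kend => /eqP ->; rewrite -!val_eqE /= ?subSS ?subn0 ?eqn_leq ?ltnn ?andbF.
by exists ord0; rewrite k0 kmax.
Qed.

Lemma gen_vprod_reversing_scale (R : comNzRingType) (n : nat) (c : R)
    (M : 'I_n.-1 -> 'rV[R]_n) :
  (4 <= n)%N -> (forall i, reversing (M i) = c *: M i) -> gen_vprod M = 0.
Proof.
move=> n_ge4 revM; rewrite /gen_vprod big1 // => k _.
have [j /and3P[kj krj rjj]] := mirror_pair_avoiding n k n_ge4.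
have [b jE _] := unlift_some kj; have [a rjE _] := unlift_some krj.
rewrite (@det_proportional_cols _ _ _ a b c) ?mulr0 ?scale0r //.
  by apply: contraNneq rjj => ab; rewrite rjE jE ab.
by move=> i; rewrite !mxE -rjE -jE; have /rowP/(_ j) := revM i; rewrite !mxE.
Qed.

Theorem mainTheorem3 (R : realType) (n : nat) (hn : (4 <= n)%N)
    (M : 'I_n.-1 -> 'rV[R]_n) :
  ((forall i : 'I_n.-1, palindromic (M i)) -> gen_vprod M = 0) /\
  ((forall i : 'I_n.-1, antipalindromic (M i)) -> gen_vprod M = 0).
Proof.
split=> revM.
  by apply: (@gen_vprod_reversing_scale _ _ 1) => // i; rewrite scale1r revM.
by apply: (@gen_vprod_reversing_scale _ _ (-1)) => // i; rewrite scaleN1r revM.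
Qed.
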